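(* We have: (a) $\mathfrak{g}_{\mathrm{DSO}}(5)=1$. Furthermore, for $v\in\mathbb{R}^5$, one has $\mathfrak{g}_{\mathrm{DSO}}(v)\geq 1$ if and only if $v$ has one of the following forms, up to an additive constant and a cyclic shift: (i) $v=\left(\lambda,\eta,\frac{\lambda+1}{\lambda\eta-1},\lambda\eta-1,\frac{\eta+1}{\lambda\eta-1}\right)$ for some $\lambda,\eta\in\mathbb{R}$ such that $\lambda\eta\neq 1$; (ii) $v=\left(\lambda,\eta,\frac{\lambda-1}{\lambda\eta-1},1-\lambda\eta,\frac{\eta-1}{\lambda\eta-1}\right)$ for some $\lambda,\eta\in\mathbb{R}$ such that $\lambda\eta\neq 1$. (b) $\mathfrak{g}_{\mathrm{ODJM}}(5)=2$. Furthermore, for $a\in\mathbb{R}_+^5$, one has $\mathfrak{g}_{\mathrm{ODJM}}(a)\geq 2$ if and only if, up to a multiplicative constant and a cyclic shift, $a$ has the form $$a=\left(\alpha,\ \beta,\ \sqrt{\frac{\alpha^2+\beta^2-1}{\alpha^2-1}},\ \frac{\alpha\beta}{\sqrt{(\alpha^2-1)(\beta^2-1)}},\ \sqrt{\frac{\alpha^2+\beta^2-1}{\beta^2-1}}\right)$$ for some $\alpha,\beta$ such that either $\alpha>1$ and $\beta>1$, or $\alpha^2+\beta^2<1$ (where $\alpha,\beta>0$, being entries of a vector in $\mathbb{R}_+^5$).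
   Context: Write $\mathbb{R}_+ = (0,\infty)$. For $a \in \mathbb{R}_+^p$ and $v \in \mathbb{R}^p$ (here $p=5$), let $J_{a,v}(\theta)$, $\theta \in \mathbb{R}$, be the Hermitian $p\times p$ matrix with diagonal entries $v_1,\dots,v_p$, entries $a_1,\dots,a_{p-1}$ on the first super- and sub-diagonals (i.e. the $(j,j+1)$ and $(j+1,j)$ entries equal $a_j$ for $1\le j\le p-1$), $(1,p)$ entry $e^{-2\pi i \theta}a_p$, $(p,1)$ entry $e^{2\pi i\theta}a_p$, and all other entries zero. (These are the Floquet matrices of the periodic Jacobi matrix $[\mathbf{J}_{a,v}\psi](n) = A(n-1)\psi(n-1)+V(n)\psi(n)+A(n)\psi(n+1)$ on $\ell^2(\mathbb{Z})$, where $A,V$ are the $p$-periodic extensions of $a,v$.) Let $\lambda_1(\theta)\le\cdots\le\lambda_p(\theta)$ be the eigenvalues of $J_{a,v}(\theta)$ counted with multiplicity, and put $\lambda_j^- = \min_{\theta\in[0,1]}\lambda_j(\theta)$, $\lambda_j^+ = \max_{\theta\in[0,1]}\lambda_j(\theta)$. It is known that $\lambda_1^-<\lambda_1^+\le\lambda_2^-<\cdots\le\lambda_p^-<\lambda_p^+$. A number $\lambda\in\mathbb{R}$ is a closed gap of $(a,v)$ if $\lambda=\lambda_j^+=\lambda_{j+1}^-$ for some $1\le j\le p-1$. Let $\mathfrak{g}(a,v)$ be the number of closed gaps of $(a,v)$ (defined for all $(a,v)$, irreducible or not); put $\mathfrak{g}_{\mathrm{DSO}}(v)=\mathfrak{g}(\mathbf{1},v)$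 for $v\in\mathbb{R}^p$, where $\mathbf{1}=(1,\dots,1)$, and $\mathfrak{g}_{\mathrm{ODJM}}(a)=\mathfrak{g}(a,\mathbf{0})$ for $a\in\mathbb{R}_+^p$, where $\mathbf{0}=(0,\dots,0)$. Let $\mathrm{cyc}(v_1,\dots,v_p)=(v_2,\dots,v_p,v_1)$. A vector $v \in \mathbb{R}^p$ is irreducible if $v,\mathrm{cyc}(v),\dots,\mathrm{cyc}^{p-1}(v)$ are pairwise distinct, and reducible otherwise. Define $\mathfrak{g}_{\mathrm{DSO}}(p)=\max\{\mathfrak{g}_{\mathrm{DSO}}(v): v\in\mathbb{R}^p \text{ irreducible}\}$ and $\mathfrak{g}_{\mathrm{ODJM}}(p)=\max\{\mathfrak{g}_{\mathrm{ODJM}}(a): a\in\mathbb{R}_+^p\text{ irreducible}\}$. ''Up to an additive constant and a cyclic shift, $v$ has the form $w$'' means that $\mathrm{cyc}^k(v)+c\mathbf{1}=w$ for some integer $k\ge 0$ and some $c\in\mathbb{R}$. ''Up to a multiplicative constant and a cyclic shift, $a$ has the form $w$'' means that $c\,\mathrm{cyc}^k(a)=w$ for some integer $k\ge 0$ and some $c>0$. *)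

(* Defs.v *)
From mathcomp Require Import all_boot all_order all_algebra.
From mathcomp Require Import all_classical all_reals all_analysis.
From mathcomp Require Import finmap complex.

Set Implicit Arguments.
Unset Strict Implicit.
Unset Printing Implicit Defensive.

Import Order.TTheory GRing.Theory Num.Theory.

Local Open Scope classical_set_scope.
Local Open Scope ring_scope.
Local Open Scope complex_scope.

Section Extrema.
Context {d : Order.disp_t} {T : porderType d}.
Implicit Type A : set T.

Definition is_max A (m : T) : Prop := A m /\ ubound A m.
Definition is_min A (m : T) : Prop := A m /\ lbound A m.

Lemma is_max_unique A m n : is_max A m -> is_max A n -> m = n.
Proof.
by case=> Am um [An un]; apply/le_anti; rewrite un //= um.
Qed.

End Extrema.

Section Cyclic.
Context {T : Type} {p : nat}.

Definition cyc (v : 'rV[T]_p) : 'rV[T]_p := \row_j v 0 (ordS j).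

Definition irreducible_vec (v : 'rV[T]_p) : Prop :=
  injective (fun k : 'I_p => iter k cyc v).

End Cyclic.

Section PeriodicJacobi.
Variable R : realType.

Definition cexp (t : R) : R[i] := cos t +i* sin t.

(* Indices are 0-based. For p >= 3 at most one of the five index conditions
   holds at each entry, so the sum just lists the nonzero entries; for p <= 2
   overlapping terms add up, as they do in the Floquet matrix. *)
Definition floquet (p : nat) (a v : 'rV[R]_p) (theta : R) : 'M[R[i]]_p :=
  \matrix_(i < p, j < p)
    ( (v 0 i)%:C *+ (i == j)
    + (a 0 i)%:C *+ (j == i.+1 :> nat)
    + (a 0 j)%:C *+ (i == j.+1 :> nat)
    + (cexp (- (2 * pi * theta)) * (a 0 j)%:C)
        *+ ((i == 0%N :> nat) && (j == p.-1 :> nat))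
    + (cexp (2 * pi * theta) * (a 0 i)%:C)
        *+ ((i == p.-1 :> nat) && (j == 0%N :> nat))).

(* The roots of the characteristic polynomial, with multiplicity. Taking real
   parts loses nothing for a Hermitian matrix, see eigenvaluesP below. *)
Definition eigenvalues (p : nat) (M : 'M[R[i]]_p) : seq R :=
  sort <=%R
    [seq complex.Re z | z <- sval (closed_field_poly_normal (char_poly M))].

(* The (j+1)-st smallest eigenvalue: j is 0-based. *)
Definition band (p : nat) (a v : 'rV[R]_p) (j : nat) (theta : R) : R :=
  nth 0 (eigenvalues (floquet a v theta)) j.

Definition band_range (p : nat) (a v : 'rV[R]_p) (j : nat) : set R :=
  [set band a v j theta | theta in `[0, 1]].

Definition closed_gap (p : nat) (a v : 'rV[R]_p) (l : R) : Prop :=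
  exists j : nat, [/\ (j.+1 < p)%N,
    is_max (band_range a v j) l & is_min (band_range a v j.+1) l].

Definition num_closed_gaps (p : nat) (a v : 'rV[R]_p) : nat :=
  #|` fset_set [set l | closed_gap a v l] |.

Definition g_DSO (p : nat) (v : 'rV[R]_p) : nat :=
  num_closed_gaps (const_mx 1) v.

Definition g_ODJM (p : nat) (a : 'rV[R]_p) : nat :=
  num_closed_gaps a (const_mx 0).

Definition positive_vec (p : nat) (a : 'rV[R]_p) : Prop :=
  forall j, 0 < a 0 j.

Definition g_DSO_max (p m : nat) : Prop :=
  is_max [set g_DSO v | v in [set v : 'rV[R]_p | irreducible_vec v]] m.

Definition g_ODJM_max (p m : nat) : Prop :=
  is_max [set g_ODJM a | a in
            [set a : 'rV[R]_p | positive_vec a /\ irreducible_vec a]] m.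

Definition add_cyc_form (p : nat) (v w : 'rV[R]_p) : Prop :=
  exists (k : nat) (c : R), iter k cyc v + const_mx c = w.

Definition mul_cyc_form (p : nat) (a w : 'rV[R]_p) : Prop :=
  exists (k : nat) (c : R), 0 < c /\ c *: iter k cyc a = w.

Definition row5 (x1 x2 x3 x4 x5 : R) : 'rV[R]_5 :=
  \row_(j < 5) [:: x1; x2; x3; x4; x5]`_j.

(* num_closed_gaps is a genuine count: fset_set is applied to a finite set. *)
Lemma finite_closed_gaps (p : nat) (a v : 'rV[R]_p) :
  finite_set [set l | closed_gap a v l].
Proof.
apply: (@sub_finite_set _ _
  (\bigcup_(j in `I_p) [set l | is_max (band_range a v j) l])).
  move=> l [j [jp jmax _]]; exists j => //=; exact: ltnW.
apply: bigcup_finite; first exact: finite_II.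
move=> j _; have [[m jm]|nm] := pselect (exists m, is_max (band_range a v j) m).
  apply: (sub_finite_set _ (finite_set1 m)) => l jl /=.
  exact: is_max_unique jl jm.
by apply: (sub_finite_set _ (finite_set0 R)) => l jl; apply: nm; exists l.
Qed.

Lemma cexp_conj (t : R) : (cexp t)^* = cexp (- t).
Proof. by rewrite /cexp cosN sinN. Qed.

Lemma floquet_herm (p : nat) (a v : 'rV[R]_p) (theta : R) :
  floquet a v theta \is hermsymmx.
Proof.
apply/is_hermitianmxP; rewrite expr0 scale1r; apply/matrixP => i j.
rewrite !mxE.
have cr (x : R) : Num.conj (x%:C) = x%:C by exact: conjc_real.
have ce (t : R) : Num.conj (cexp t) = cexp (- t) by exact: cexp_conj.
rewrite !raddfD !raddfMn /= !rmorphM /= !cr !ce opprK.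
rewrite [j == i]eq_sym [X in _ = X + _ + _ + _ + _](_ : _ = (v 0 i)%:C *+ (i == j)).
  2: by case: eqVneq => [->|].
rewrite [(j == 0%N :> nat) && _]andbC [(j == p.-1 :> nat) && _]andbC.
move: (cexp _ * _ *+ _) (cexp _ * _ *+ _) ((a 0 i)%:C *+ _) ((a 0 j)%:C *+ _).
move: ((v 0 i)%:C *+ _).
by move=> x y z t u; rewrite [RHS]addrAC [x + _ + _]addrAC.
Qed.

Lemma eigenvaluesP (p : nat) (M : 'M[R[i]]_p) : M \is hermsymmx ->
  sorted <=%R (eigenvalues M) /\
  char_poly M = \prod_(x <- eigenvalues M) ('X - (x%:C)%:P).
Proof.
move=> Mh; split; first by apply: sort_sorted; exact: le_total.
rewrite /eigenvalues; case: closed_field_poly_normal => s /= Es.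
have := Es; rewrite (monicP (char_poly_monic M)) scale1r => Es1.
rewrite (perm_big _ (permEl (perm_sort _ _))) /= big_map {1}Es1.
rewrite !big_seq; apply: eq_bigr => z zs; congr ('X - _%:P); apply/esym.
have rz : root (char_poly M) z by rewrite Es1 root_prod_XsubC.
move: rz; rewrite -eigenvalue_root_char => /eigenvalueP[v vM v0].
have /hermitian_normalmx/orthomx_spectralP ME := Mh.
set P := spectralmx M in ME; set D := spectral_diag M in ME.
have Pu : P \in unitmx := spectral_unit M.
pose w := v *m invmx P.
have wD : w *m diag_mx D = z *: w.
  by rewrite /w scalemxAl -vM ME !mulmxA mulmxK.
have w0 : w != 0.
  by apply: contra v0 => /eqP w0; rewrite -(mulmxKV Pu v) -/w w0 mul0mx.
have [i wi] : exists i, w 0 i != 0 by apply/rV0Pn.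
have zD : D 0 i = z.
  apply: (mulIf wi); rewrite mulrC.
  have := congr1 (fun u : 'rV_p => u 0 i) wD.
  by rewrite mul_mx_diag [LHS]mxE [RHS]mxE.
have /mxOverP/(_ 0 i) := hermitian_spectral_diag_real Mh.
rewrite -/D zD => /Creal_ReP zr.
by rewrite -[RHS]zr -complexRe.
Qed.

End PeriodicJacobi.

(* Main.v *)
From HB Require Import structures.
Require Import Defs.
From mathcomp Require Import all_boot all_order all_algebra.
From mathcomp Require Import all_classical all_reals all_analysis.
From mathcomp Require Import finmap complex polyrcf polyorder ring lra zify.

Set Implicit Arguments.
Unset Strict Implicit.
Unset Printing Implicit Defensive.

Import Order.TTheory GRing.Theory Num.Theory.

Local Open Scope ring_scope.

(** Write x_i = l - v_i and s_i = a_i ^ 2. Expanding the determinant along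
the five-cycle gives det (l - J(theta)) = P(l) - 2 A cos (2 pi theta), where P is
independent of theta and A is the product of the a_i; the union of the bands is
thus the preimage under P of the interval from -2A to 2A. Let D_i(l) be the determinant of
what remains of l - J when vertex i is deleted: a path on four vertices, so again
independent of theta. The whole proof rests on the equivalence [closed_gapP]:

  l is a closed gap if and only if D_i(l) = 0 for all five i.

One half of it is algebra. Since P' is the sum of the D_i, and since the Jacobi
identities [chain4_mul_adjacent] and [chain4_mul_skip] write, once the square is
completed, a positive multiple of D_i D_j as a square plus a nonnegative multiple
(positive for neighbours i, j) of 4 A^2 - P^2, the D_i have
the same weak sign wherever P^2 <= 4 A^2. Hence P' has no zero with P^2 < 4 A^2,
and at an edge P^2 = 4 A^2 it vanishes only if all the D_i do
([edge_degenerateP]). The other half relates this to the extrema of the bands: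
all the polynomials P - c have the same derivative, whose roots are simple, and
these roots separate the roots of P - c for every admissible c
([common_interlacing]). So a point where two consecutive bands take the same
value is a root of P', and conversely a double root of P - c, being a root of
P', bounds the band below it from above and the band above it from below.

For a = 1 the five equations D_i = 0 say that w = v - l satisfies
w_i w_(i+1) - 1 = k w_(i+3) with k = 1 or k = -1, the recurrence of frieze
patterns for the pentagon. Solving it for the last three entries in terms of the
first two gives the two families of the theorem. If w and a translate w - t of it
both satisfy such a recurrence with t <> 0, then w is constant
([pentagon_pair_constant]), and a constant vector is reducible; so an irreducible
v has at most one closed gap.

For v = 0 each D_i is a quadratic polynomial in l ^ 2, so closed gaps come in
pairs l, -l, and after scaling by 1 / l the equations become
t_(i+1) = (1 - t_i) (1 - t_(i+2)) for the squares t_i. Solving for the last three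
entries gives the stated form, and positivity leaves the two regions for the
parameters ([unit_gap_relation_cases]). If two distinct values of l ^ 2 occur,
Vieta's formulas make s_i + s_(i+1) + s_(i+2) independent of i, hence a constant;
so an irreducible a has at most two closed gaps. *)

(** * Real-rooted polynomials *)

Section RealRooted.
Variable R : rcfType.
Implicit Types (e r : seq R) (x : R) (f g : {poly R}).

Definition monic_of_roots e : {poly R} := \prod_(y <- e) ('X - y%:P).
Local Notation mr := monic_of_roots.

Lemma monic_of_roots_split e1 x e2 :
  mr (e1 ++ x :: e2) = ('X - x%:P) * mr (e1 ++ e2).
Proof. by rewrite /mr !big_cat big_cons /=; ring. Qed.

Lemma size_monic_of_roots e : size (mr e) = (size e).+1.
Proof. exact: size_prod_XsubC. Qed.

Lemma root_monic_of_roots e x : root (mr e) x = (x \in e).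
Proof. exact: root_prod_XsubC. Qed.

Lemma double_root_split e x : (mr e).[x] = 0 -> (mr e)^`().[x] = 0 ->
  exists e1 e2, [/\ e = e1 ++ x :: e2, x \notin e1 & x \in e2].
Proof.
move/rootP; rewrite root_monic_of_roots => xe.
have [e1 [e2 [-> xe1]]] : exists e1 e2, e = e1 ++ x :: e2 /\ x \notin e1.
  exists (take (index x e) e), (drop (index x e).+1 e); split.
    rewrite -[LHS](cat_take_drop (index x e)) (drop_nth x) ?index_mem //.
    by rewrite nth_index.
  by apply/negP => /index_ltn; rewrite ltnn.
rewrite monic_of_roots_split derivM derivXsubC mul1r !hornerE subrr mul0r addr0.
move/rootP; rewrite root_monic_of_roots mem_cat (negPf xe1) => xe2.
by exists e1, e2.
Qed.

Lemma double_root_adjacent e x : sorted <=%R e ->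
    (mr e).[x] = 0 -> (mr e)^`().[x] = 0 ->
  exists k, [/\ (k.+1 < size e)%N, e`_k = x & e`_k.+1 = x].
Proof.
move=> se f0 df0; have [e1 [[|y e2] [def_e _ //]]] := double_root_split f0 df0.
move=> xe2; exists (size e1).
have /andP[_ /= /andP[xy ye2]] : sorted <=%R e1 && sorted <=%R [:: x, y & e2].
  by rewrite def_e in se; have /cat_sorted2[-> ->] := se.
rewrite def_e size_cat /= !nth_cat ltnn subnn subSnn.
have -> : ((size e1).+1 < size e1)%N = false by lia.
split => //=; first by lia.
apply/le_anti; rewrite xy andbT.
move: xe2; rewrite inE => /orP[/eqP-> //|xe2].
by have /allP/(_ x xe2) := order_path_min le_trans ye2.
Qed.

Lemma simple_roots e x : uniq e -> (mr e).[x] = 0 -> (mr e)^`().[x] != 0.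
Proof.
move=> ue f0; apply/eqP => df0.
have [e1 [e2 [def_e _ xe2]]] := double_root_split f0 df0.
by move: ue; rewrite def_e cat_uniq /= xe2 !andbF.
Qed.

Lemma triple_root e x i : (i.+2 < size e)%N ->
    e`_i = x -> e`_i.+1 = x -> e`_i.+2 = x ->
  (mr e)^`().[x] = 0 /\ (mr e)^`()^`().[x] = 0.
Proof.
move=> ie e0 e1 e2; rewrite -[e](cat_take_drop i).
rewrite (drop_nth 0) ?(drop_nth 0 (n := i.+1)) ?(drop_nth 0 (n := i.+2)) //; try exact: ltnW; try exact: ltnW (ltnW ie).
rewrite e0 e1 e2 !monic_of_roots_split.
set q := mr _; rewrite !(derivM, derivXsubC, derivD, mul1r) !hornerE /= !subrr.
by rewrite !(mul0r, addr0).
Qed.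

Lemma monic_of_roots_nth e i : (i < size e)%N -> (mr e).[e`_i] = 0.
Proof. by move=> ie; apply/rootP; rewrite root_monic_of_roots mem_nth. Qed.

(** Rolle's theorem, including the degenerate interval, for which a double root
plays the role of the interior point. *)
Lemma weak_rolle f a b : a <= b -> f.[a] = f.[b] -> (a = b -> f^`().[a] = 0) ->
  {s | [/\ a <= s <= b, f^`().[s] = 0 & a < b -> a < s < b]}.
Proof.
move=> ab fab dfa; case: (eqVneq a b) => [eab|nab].
  by exists a; rewrite -eab !lexx ltxx; split => //; apply: dfa.
have ltab : a < b by rewrite lt_neqAle nab.
have [s] := poly_rolle ltab fab; rewrite in_itv /= => /andP[a_s sb] dfs.
by exists s; rewrite (ltW a_s) (ltW sb) a_s sb.
Qed.

Lemma equal_adjacent_double e i : (i.+1 < size e)%N -> e`_i = e`_i.+1 ->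
  (mr e)^`().[e`_i] = 0.
Proof.
move=> ie eqe; rewrite -{1}[e](cat_take_drop i).
rewrite (drop_nth 0) ?(drop_nth 0 (n := i.+1)) //; try exact: ltnW.
rewrite -eqe !monic_of_roots_split.
set q := mr _; rewrite !(derivM, derivXsubC, mul1r) !hornerE /= !subrr.
by rewrite !(mul0r, addr0).
Qed.

(** Excluding triple roots is what makes the chosen roots of the derivative
strictly increasing: two of them can only meet at a common end point of their
intervals, and then both intervals are degenerate. *)
Lemma deriv_roots_interlace n e : size e = n.+1 -> sorted <=%R e ->
    (forall i, (i.+2 < size e)%N -> e`_i = e`_i.+1 -> e`_i.+1 <> e`_i.+2) ->
  exists r, [/\ size r = n, sorted <%R r, all (root (mr e)^`()) r &
    forall i, (i < n)%N -> e`_i <= r`_i <= e`_i.+1].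
Proof.
move=> szE se simple.
have le_e i : (i < n)%N -> e`_i <= e`_i.+1.
  by move=> ltin; apply: (sorted_leq_nth le_trans lexx 0 se); rewrite ?inE ?szE // ltnW.
have rolle i : {s | (i < n)%N -> [/\ e`_i <= s <= e`_i.+1, (mr e)^`().[s] = 0
                                   & e`_i < e`_i.+1 -> e`_i < s < e`_i.+1]}.
  have [ltin|] := boolP (i < n)%N; last by exists 0.
  have [|e_eq|s Hs] := weak_rolle (f := mr e) (le_e i ltin).
  - by rewrite !monic_of_roots_nth // szE // ltnW.
  - by apply: equal_adjacent_double => //; rewrite szE.
  by exists s.
pose s i := sval (rolle i).
have sP i : (i < n)%N -> _ := svalP (rolle i).
exists (mkseq s n); rewrite size_mkseq; split => //.
- apply/(sortedP 0) => i; rewrite size_mkseq => ltin; rewrite !nth_mkseq //; last lia.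
  have [/andP[_ s_hi] ds_i s_i] := sP i (ltnW ltin).
  have [/andP[s_lo _] ds_i1 s_i1] := sP _ ltin.
  rewrite -/(s i) -/(s i.+1) in s_hi ds_i s_i s_lo ds_i1 s_i1.
  rewrite lt_neqAle (le_trans s_hi s_lo) andbT; apply/eqP => ss.
  (* A coincidence forces both gaps to be degenerate, as Rolle's point would
     otherwise be interior. *)
  have es : e`_i.+1 = s i by apply/le_anti; rewrite s_hi ss s_lo.
  have e0 : e`_i = s i.
    apply/eqP; rewrite -es; apply: contraTT (le_e i (ltnW ltin)) => ne.
    apply/negP => le01; have /s_i/andP[_] : e`_i < e`_i.+1 by rewrite lt_neqAle ne.
    by rewrite es ltxx.
  have e2 : e`_i.+2 = s i.
    apply/eqP; rewrite -es eq_sym; apply: contraTT (le_e i.+1 ltin) => ne.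
    apply/negP => le12; have /s_i1/andP[] : e`_i.+1 < e`_i.+2 by rewrite lt_neqAle ne.
    by rewrite es ss ltxx.
  by apply: (simple i); rewrite ?szE ?e0 ?es ?e2.
- by apply/(all_nthP 0) => i; rewrite size_mkseq => ltin; rewrite nth_mkseq //;
    apply/rootP; have [] := sP i ltin.
- by move=> i ltin; rewrite nth_mkseq //; have [] := sP i ltin.
Qed.

Lemma complete_roots_uniq g n r r' : g != 0 -> (size g <= n.+1)%N ->
    size r = n -> size r' = n -> sorted <%R r -> sorted <%R r' ->
    all (root g) r -> all (root g) r' -> r = r'.
Proof.
move=> g0 sg szr szr' sr sr' rr rr'.
apply: lt_sorted_eq => //.
have ur := sorted_uniq lt_trans (ltxx (T := R)) sr.
have ur' := sorted_uniq lt_trans (ltxx (T := R)) sr'.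
have sub : {subset r <= r'}.
  move=> y yr; apply: contraLR sg => yr'; rewrite -ltnNge.
  have := @max_poly_roots _ g (y :: r') g0; rewrite /= szr' rr' (allP rr) // yr' ur'.
  by apply.
by apply: (uniq_min_size ur sub _).2; rewrite szr szr'.
Qed.

(** The derivative of a polynomial with distinct real roots has simple roots, and
there are as many of them as its degree allows. A real-rooted polynomial with the
same derivative therefore has no triple root, and the roots of the derivative that
separate its own roots can only be the same ones. *)
Lemma common_interlacing n e0 : size e0 = n.+1 -> sorted <%R e0 ->
  exists r, forall e, size e = n.+1 -> sorted <=%R e ->
    (mr e)^`() = (mr e0)^`() -> forall i, (i < n)%N -> e`_i <= r`_i <= e`_i.+1.
Proof.
move=> sz0 s0; have ltxx_ := @ltxx _ R.
have szd : size (mr e0)^`() = n.+1.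
  by rewrite size_deriv size_monic_of_roots sz0.
have [|i ie e01|r [szr sr rr _]] := deriv_roots_interlace sz0.
- exact: (sub_sorted (@ltW _ R) s0).
- have := sorted_ltn_nth lt_trans 0 s0 i i.+1.
  by rewrite !inE e01 ltxx (ltnW ie) (ltnW (ltnW ie)) ltnSn => /(_ isT isT isT).
have ur := sorted_uniq lt_trans ltxx_ sr.
have def_d : (mr e0)^`() = lead_coef (mr e0)^`() *: mr r.
  by apply: all_roots_prod_XsubC; rewrite ?szr // uniq_rootsE.
have d0 : (mr e0)^`() != 0 by rewrite -size_poly_gt0 szd.
exists r => e sze se de.
have [|r' [szr' sr' rr' inter]] := deriv_roots_interlace sze se.
  move=> i ie e01 e12; have [df ddf] := triple_root ie e01 erefl (esym e12).
  have rx : (mr r).[e`_i.+1] = 0.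
    apply/eqP; move: df; rewrite de def_d hornerZ => /eqP.
    by rewrite mulf_eq0 lead_coef_eq0 (negPf d0).
  move: ddf; rewrite de def_d derivZ hornerZ => /eqP.
  by rewrite mulf_eq0 lead_coef_eq0 (negPf d0) (negPf (simple_roots ur rx)).
suff -> : r = r' by [].
by apply: (complete_roots_uniq (g := (mr e0)^`()) (n := n)); rewrite ?szd // -de.
Qed.

Lemma simple_roots_strictly_sorted e : sorted <=%R e ->
  (forall x, (mr e).[x] = 0 -> (mr e)^`().[x] != 0) -> sorted <%R e.
Proof.
move=> se simple; apply/(sortedP 0) => i ie.
rewrite lt_neqAle (sorted_leq_nth le_trans lexx 0 se) ?inE ?(ltnW ie) // andbT.
apply/eqP => ei; have := simple _ (monic_of_roots_nth (ltnW ie)).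
by rewrite equal_adjacent_double ?eqxx.
Qed.

End RealRooted.

Local Notation mr := monic_of_roots.

(** * The five-cycle and the determinants of its paths *)

Local Notation σ := (@ordS 5).

(** Concrete indices, chosen so that identities between five cyclic unknowns reduce
to ring identities by rewriting with [ordS_vtx]. *)
Definition vtx (k : nat) : 'I_5 := inord k.

Lemma ordS_vtx : (σ (vtx 0) = vtx 1) * (σ (vtx 1) = vtx 2) *
  (σ (vtx 2) = vtx 3) * (σ (vtx 3) = vtx 4) * (σ (vtx 4) = vtx 0).
Proof. by do !split; apply/val_inj; rewrite /= !inordK. Qed.

Lemma vtxP (Q : 'I_5 -> Prop) :
  Q (vtx 0) -> Q (vtx 1) -> Q (vtx 2) -> Q (vtx 3) -> Q (vtx 4) -> forall i, Q i.
Proof.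
move=> Q0 Q1 Q2 Q3 Q4 i; rewrite -(inord_val i).
by case: i => [[|[|[|[|[|]]]]]].
Qed.

Lemma sum_vtx (V : nmodType) (F : 'I_5 -> V) :
  \sum_i F i = F (vtx 0) + (F (vtx 1) + (F (vtx 2) + (F (vtx 3) + F (vtx 4)))).
Proof.
rewrite !big_ord_recl big_ord0 addr0.
by do !congr (_ + _); congr F; apply/val_inj; rewrite /= ?inordK.
Qed.

Lemma vtxK k : (k < 5)%N -> vtx k = k :> nat.
Proof. exact: inordK. Qed.

Lemma vtx_eq k l : (k < 5)%N -> (l < 5)%N -> (vtx k == vtx l) = (k == l).
Proof. by move=> k5 l5; rewrite -val_eqE /= !inordK. Qed.

Lemma iter_ordS n k (i : 'I_n) : iter k (@ordS n) i = ((i + k) %% n)%N :> nat.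
Proof.
elim: k => [|k IHk]; first by rewrite addn0 modn_small.
by rewrite iterS /= IHk addnS -addn1 modnDml addn1.
Qed.

Lemma ordS_orbit n (i j : 'I_n) : exists2 k, (k < n)%N & iter k (@ordS n) i = j.
Proof.
have n_gt0 : (0 < n)%N by apply: leq_ltn_trans (ltn_ord i).
exists ((j + (n - i)) %% n)%N; first by rewrite ltn_pmod.
apply/val_inj; rewrite /= iter_ordS modnDmr addnCA subnKC; last exact: ltnW.
by rewrite modnDr modn_small.
Qed.

Lemma iter_ordS_surj n k (Q : 'I_n -> Prop) :
  (forall i, Q (iter k (@ordS n) i)) -> forall i, Q i.
Proof.
elim: k => [//|k IHk] H; apply: IHk => i.
by rewrite -(ord_predK i) -iterSr.
Qed.

Lemma ordS5 (i : 'I_5) : σ (σ (σ (σ (σ i)))) = i.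
Proof. by move: i; apply: vtxP; rewrite !ordS_vtx. Qed.

Section Chains.
Variables (R : comNzRingType) (x s : 'I_5 -> R).

(** With diagonal entries x i and squared couplings s i between i and its successor,
[chain2], [chain3], [chain4] are the determinants of the Jacobi matrices of the
paths on 2, 3, 4 consecutive vertices starting at i. They are the usual continuants,
with signs of the off-diagonal entries immaterial. *)
Definition chain2 i := x i * x (σ i) - s i.
Definition chain3 i := x i * chain2 (σ i) - s i * x (σ (σ i)).
Definition chain4 i := x i * chain3 (σ i) - s i * chain2 (σ (σ i)).
(** The determinant of the five-cycle without the two terms that run once around the
cycle: expand at vertex 0, whose neighbours are 1 and 4. *)
Definition disc :=
  x (vtx 0) * chain4 (vtx 1) - s (vtx 0) * chain3 (vtx 2) - s (vtx 4) * chain3 (vtx 1).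
Definition weight := s (vtx 0) * s (vtx 1) * s (vtx 2) * s (vtx 3) * s (vtx 4).

Local Ltac by_rotation :=
  rewrite /disc /weight /chain4 /chain3 /chain2 ?ordS_vtx; ring.

Lemma disc_rotate i :
  disc = x (σ i) * chain4 (σ (σ i)) - s (σ i) * chain3 (σ (σ (σ i)))
         - s i * chain3 (σ (σ i)).
Proof. by move: i; apply: vtxP; by_rotation. Qed.

(** Jacobi's identity for the complementary minors of two vertices, here
neighbours: the product of the two principal minors is the determinant times the
doubly deleted minor plus the modulus squared of the off-diagonal cofactor. Both
summands depend on theta through the same cosine term, with opposite signs, so
that it cancels. *)
Lemma chain4_mul_adjacent i : s i * (chain4 (σ i) * chain4 (σ (σ i))) =
  (s i * chain3 (σ (σ i))) ^+ 2 + disc * (s i * chain3 (σ (σ i))) + weight.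
Proof. by move: i; apply: vtxP; by_rotation. Qed.

(** The same identity for two vertices at distance two. *)
Lemma chain4_mul_skip i :
  s i * s (σ i) * (chain4 (σ i) * chain4 (σ (σ (σ i)))) =
  (s i * s (σ i) * chain2 (σ (σ (σ i)))) ^+ 2
  + disc * x (σ i) * (s i * s (σ i) * chain2 (σ (σ (σ i))))
  + weight * x (σ i) ^+ 2.
Proof. by move: i; apply: vtxP; by_rotation. Qed.

End Chains.

Section Degeneracy.
Variables (R : realFieldType) (x s : 'I_5 -> R).
Hypothesis s_gt0 : forall i, 0 < s i.
Local Notation chain4 := (chain4 x s).
Local Notation chain3 := (chain3 x s).
Local Notation disc := (disc x s).
Local Notation weight := (weight s).

Lemma weight_gt0 : 0 < weight.
Proof. by rewrite /weight !mulr_gt0. Qed.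

Lemma chain4_adjacent_gt0 i : disc ^+ 2 < 4 * weight ->
  0 < chain4 (σ i) * chain4 (σ (σ i)).
Proof.
move=> inside; rewrite -(pmulr_rgt0 _ (s_gt0 i)) chain4_mul_adjacent.
have := sqr_ge0 (s i * chain3 (σ (σ i)) + disc / 2); lra.
Qed.

Lemma chain4_adjacent_ge0 i : disc ^+ 2 <= 4 * weight ->
  0 <= chain4 (σ i) * chain4 (σ (σ i)).
Proof.
move=> inside; rewrite -(pmulr_rge0 _ (s_gt0 i)) chain4_mul_adjacent.
have := sqr_ge0 (s i * chain3 (σ (σ i)) + disc / 2); lra.
Qed.

Lemma chain4_skip_ge0 i : disc ^+ 2 <= 4 * weight ->
  0 <= chain4 (σ i) * chain4 (σ (σ (σ i))).
Proof.
move=> inside; rewrite -(pmulr_rge0 _ (mulr_gt0 (s_gt0 i) (s_gt0 (σ i)))).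
rewrite chain4_mul_skip; set u := s i * _ * _; set b := x (σ i).
have := sqr_ge0 (u + disc * b / 2).
have : 0 <= (4 * weight - disc ^+ 2) * b ^+ 2 by rewrite mulr_ge0 ?sqr_ge0 // subr_ge0.
lra.
Qed.

(** Neighbouring determinants have equal strict signs, so all five have. *)
Lemma sum_chain4_neq0 : disc ^+ 2 < 4 * weight -> \sum_i chain4 i != 0.
Proof.
move=> inside; have adj := fun i => chain4_adjacent_gt0 i inside.
have := adj (vtx 0); have := adj (vtx 1); have := adj (vtx 2); have := adj (vtx 3).
rewrite !ordS_vtx sum_vtx.
move: (chain4 _) (chain4 _) (chain4 _) (chain4 _) (chain4 _) => d0 d1 d2 d3 d4.
by case: (ltrgt0P d0) => [?|?|->]; case: (ltrgt0P d1) => [?|?|->];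
  case: (ltrgt0P d2) => [?|?|->]; case: (ltrgt0P d3) => [?|?|->];
  case: (ltrgt0P d4) => [?|?|->]; rewrite ?mul0r ?mulr0 ?ltxx // => *; nra.
Qed.

(** Two consecutive terms s i * chain3 add up to - disc, so such terms two steps
apart agree; as five is odd, all of them agree. *)
Lemma degenerate_chain3 : (forall i, chain4 i = 0) ->
  forall i, s i * chain3 (σ (σ i)) = - disc / 2.
Proof.
move=> all0.
have rot i : disc = - (s (σ i) * chain3 (σ (σ (σ i)))) - s i * chain3 (σ (σ i)).
  by rewrite (disc_rotate x s i) all0 mulr0 sub0r.
have := (rot (vtx 0), rot (vtx 1), rot (vtx 2), rot (vtx 3), rot (vtx 4)).
rewrite !ordS_vtx => -[] [] [] [] r0 r1 r2 r3 r4.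
by apply: vtxP; rewrite !ordS_vtx; lra.
Qed.

(** All products of two of the five determinants are nonnegative at an edge, and
the square of their sum is the sum of their squares plus twice these products.
Conversely, [degenerate_chain3] makes the square in the Jacobi identity vanish. *)
Lemma edge_degenerateP :
  (\sum_i chain4 i = 0 /\ disc ^+ 2 = 4 * weight) <-> forall i, chain4 i = 0.
Proof.
split=> [[d0 edge]|all0].
  have edge' : disc ^+ 2 <= 4 * weight by rewrite edge.
  have adj := fun i => chain4_adjacent_ge0 i edge'.
  have skip := fun i => chain4_skip_ge0 i edge'.
  have := (adj (vtx 0), adj (vtx 1), adj (vtx 2), adj (vtx 3), adj (vtx 4),
    skip (vtx 0), skip (vtx 1), skip (vtx 2), skip (vtx 3), skip (vtx 4)).
  have := f_equal (fun z => z ^+ 2) d0.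
  rewrite !ordS_vtx sum_vtx => sq0 [] [] [] [] [] [] [] [] [] p1 p2 p3 p4 p5 p6 p7 p8 p9 p10.
  have sqs i : 0 <= chain4 i ^+ 2 by exact: sqr_ge0.
  have := (sqs (vtx 0), sqs (vtx 1), sqs (vtx 2), sqs (vtx 3), sqs (vtx 4)).
  case=> [] [] [] [] q0 q1 q2 q3 q4.
  apply: vtxP; apply/eqP; rewrite -sqrf_eq0 eq_le ?q0 ?q1 ?q2 ?q3 ?q4 andbT; nra.
split; first by apply: big1.
have := chain4_mul_adjacent x s (vtx 0); rewrite !all0 !mulr0.
by rewrite degenerate_chain3 //; lra.
Qed.

End Degeneracy.

(** * Characteristic polynomials of Floquet matrices *)

Section Determinant.
Variable S : comNzRingType.

(** Expansion along the first row as a list fold, which simplification evaluates for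
a matrix of numeral size whose entries are given by pattern matching. *)
Fixpoint laplace n (f : nat -> nat -> S) : S :=
  if n is m.+1 then
    foldr +%R 0 [seq f 0 j * ((-1) ^+ j * laplace m (fun i k => f i.+1 (bump j k)))
                | j <- iota 0 n]
  else 1.

Lemma det_laplace n (f : nat -> nat -> S) :
  \det (\matrix_(i < n, j < n) f i j) = laplace n f.
Proof.
elim: n f => [|n IHn] f; first by rewrite det_mx00.
have -> : laplace n.+1 f = \sum_(0 <= j < n.+1)
    f 0 j * ((-1) ^+ j * laplace n (fun i k => f i.+1 (bump j k))).
  by rewrite [LHS]foldrE big_map /index_iota subn0.
rewrite big_mkord (expand_det_row _ ord0); apply: eq_bigr => j _.
rewrite mxE /cofactor add0n -IHn.
by congr (_ * (_ * \det _)); apply/matrixP => i k; rewrite !mxE.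
Qed.

Definition cyclic_entry (x b : 'I_5 -> S) (z w : S) (i j : nat) : S :=
  match i, j with
  | 0, 0 => x (vtx 0) | 0, 1 => - b (vtx 0) | 0, 4 => - (z * b (vtx 4))
  | 1, 0 => - b (vtx 0) | 1, 1 => x (vtx 1) | 1, 2 => - b (vtx 1)
  | 2, 1 => - b (vtx 1) | 2, 2 => x (vtx 2) | 2, 3 => - b (vtx 2)
  | 3, 2 => - b (vtx 2) | 3, 3 => x (vtx 3) | 3, 4 => - b (vtx 3)
  | 4, 0 => - (w * b (vtx 4)) | 4, 3 => - b (vtx 3) | 4, 4 => x (vtx 4)
  | _, _ => 0
  end.

(** The two permutations that run once around the cycle contribute the products of
the entries b with the phases z and w; all other terms see the phases at most
through z * w = 1. *)
Lemma det_cyclic (x b : 'I_5 -> S) (z w : S) : z * w = 1 ->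
  \det (\matrix_(i < 5, j < 5) cyclic_entry x b z w i j) =
  disc x (fun i => b i ^+ 2) - (z + w) *
    (b (vtx 0) * b (vtx 1) * b (vtx 2) * b (vtx 3) * b (vtx 4)).
Proof.
move=> zw; rewrite det_laplace /= !(mul0r, mulr0, add0r, addr0).
rewrite /disc /chain4 /chain3 /chain2 !ordS_vtx.
ring: zw.
Qed.

End Determinant.

Lemma rmorph_disc (S T : comNzRingType) (f : {rmorphism S -> T}) (x s : 'I_5 -> S) :
  f (disc x s) = disc (f \o x) (f \o s).
Proof.
by rewrite /disc /chain4 /chain3 /chain2 /= !(rmorphB, rmorphM, rmorphD).
Qed.

Definition edge_weight (R : realType) (a : 'rV[R]_5) (i : 'I_5) : R := a 0 i ^+ 2.

(** Locked so that unification never expands a polynomial of degree five. *)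
HB.lock Definition floquet_disc (R : realType) (a v : 'rV[R]_5) : {poly R} :=
  disc (fun i => 'X - (v 0 i)%:P) (fun i => (edge_weight a i)%:P).

Section Floquet.
Variables (R : realType) (a v : 'rV[R]_5).
Local Notation edge_weight := (edge_weight a).
Local Notation floquet_disc := (floquet_disc a v).

Definition hopping : R :=
  a 0 (vtx 0) * a 0 (vtx 1) * a 0 (vtx 2) * a 0 (vtx 3) * a 0 (vtx 4).
(** The values of [floquet_disc] at the eigenvalues of the Floquet matrix. *)
Definition bloch_level (theta : R) : R := 2 * hopping * cos (2 * pi * theta).

Lemma cexp_mulN (t : R) : cexp (- t) * cexp t = 1.
Proof.
rewrite /cexp cosN sinN; have := cos2Dsin2 t; rewrite !expr2 => c.
by congr (_ +i* _)%C; [rewrite -c|]; ring.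
Qed.

Lemma cexp_addN (t : R) : cexp (- t) + cexp t = (2 * cos t)%:C%C.
Proof. by rewrite /cexp cosN sinN; congr (_ +i* _)%C; ring. Qed.

Lemma char_poly_mx_floquet theta : char_poly_mx (floquet a v theta) =
  \matrix_(i < 5, j < 5) cyclic_entry
    (fun i => 'X - ((v 0 i)%:C%C)%:P) (fun i => ((a 0 i)%:C%C)%:P)
    (cexp (- (2 * pi * theta)))%:P (cexp (2 * pi * theta))%:P i j.
Proof.
apply/matrixP => i j; rewrite !mxE; move: i j.
apply: vtxP; apply: vtxP;
  rewrite ?vtx_eq // ?vtxK //= !(mulr0n, mulr1n, addr0, add0r) ?sub0r ?subr0 //;
  by rewrite ?polyCM ?polyC0 ?oppr0.
Qed.

Lemma char_poly_floquet theta : char_poly (floquet a v theta) =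
  map_poly (real_complex R) (floquet_disc - (bloch_level theta)%:P).
Proof.
rewrite /char_poly char_poly_mx_floquet det_cyclic; last first.
  by rewrite -polyCM cexp_mulN.
rewrite floquet_disc.unlock rmorphB /= rmorph_disc map_polyC /=.
rewrite -polyCD cexp_addN -!polyCM -!rmorphM /=.
congr (disc _ _ - (real_complex R _)%:P).
- by apply: funext => k; rewrite /= map_polyXsubC.
- by apply: funext => k; rewrite /= map_polyC /edge_weight /= !rmorphXn.
by rewrite /bloch_level /hopping; ring.
Qed.

Lemma bands_are_roots theta : exists e,
  [/\ forall j, band a v j theta = e`_j, size e = 5%N, sorted <=%R e
    & mr e = floquet_disc - (bloch_level theta)%:P].
Proof.
have [se def_char] := eigenvaluesP (floquet_herm a v theta).
exists (eigenvalues (floquet a v theta)); rewrite /band.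
move: (eigenvalues _) se def_char => e se def_char.
have def_e : map_poly (real_complex R) (mr e) = char_poly (floquet a v theta).
  by rewrite def_char rmorph_prod; apply: eq_bigr => y _; rewrite /= map_polyXsubC.
split=> //; last by apply: (map_poly_inj (real_complex R)); rewrite def_e char_poly_floquet.
have := size_char_poly (floquet a v theta).
by rewrite -def_e size_map_poly size_monic_of_roots => -[].
Qed.

Lemma horner_floquet_disc l :
  floquet_disc.[l] = disc (fun i => l - v 0 i) edge_weight.
Proof.
rewrite floquet_disc.unlock /disc /chain4 /chain3 /chain2.
by rewrite !(hornerD, hornerN, hornerM, hornerX, hornerC).
Qed.

Lemma deriv_floquet_disc l :
  floquet_disc^`().[l] = \sum_i chain4 (fun i => l - v 0 i) edge_weight i.
Proof.
rewrite sum_vtx floquet_disc.unlock /disc /chain4 /chain3 /chain2 !ordS_vtx.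
have dX : ('X : {poly R})^`().[l] = 1 by rewrite derivX hornerC.
rewrite !(derivC, derivB, derivM) !(dX, hornerD, hornerN, hornerM, hornerX, hornerC); ring.
Qed.

Lemma weight_hopping : weight edge_weight = hopping ^+ 2.
Proof. by rewrite /weight /edge_weight /hopping; ring. Qed.

Lemma bloch_level_bound theta : bloch_level theta ^+ 2 <= 4 * weight edge_weight.
Proof.
rewrite weight_hopping /bloch_level !exprMn.
have := cos2Dsin2 (2 * pi * theta); have := sqr_ge0 (sin (2 * pi * theta)).
have := sqr_ge0 hopping; nra.
Qed.

(** The edges are the periodic and antiperiodic points, theta = 0 and 1 / 2. *)
Lemma edge_attained l : disc (fun i => l - v 0 i) edge_weight ^+ 2 = 4 * weight edge_weight ->
  exists2 theta, 0 <= theta <= 1 & bloch_level theta = floquet_disc.[l].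
Proof.
rewrite weight_hopping horner_floquet_disc; set d := disc _ _ => edge.
have : (d - 2 * hopping) * (d + 2 * hopping) = 0 by lra.
move/eqP; rewrite mulf_eq0 => /orP[] /eqP d0.
  by exists 0; rewrite ?lexx ?ler01 // /bloch_level !mulr0 cos0; lra.
exists (1 / 2); first lra.
rewrite /bloch_level (_ : 2 * pi * (1 / 2) = pi); last by field.
by rewrite cospi; lra.
Qed.

Hypothesis a_gt0 : positive_vec a.

Lemma edge_weight_gt0 i : 0 < edge_weight i.
Proof. by rewrite exprn_gt0. Qed.

Lemma bloch_level_root theta l e : mr e = floquet_disc - (bloch_level theta)%:P ->
  l \in e -> bloch_level theta = floquet_disc.[l].
Proof.
rewrite -root_monic_of_roots => -> /rootP.
by rewrite hornerD hornerN hornerC => /eqP; rewrite subr_eq0 => /eqP.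
Qed.

Lemma band_level t1 t2 j : bloch_level t1 = bloch_level t2 ->
  band a v j t1 = band a v j t2.
Proof. by rewrite /band /eigenvalues !char_poly_floquet => ->. Qed.

Lemma deriv_shifted_disc f (c : R) : f = floquet_disc - c%:P -> f^`() = floquet_disc^`().
Proof. by move=> ->; rewrite derivB derivC subr0. Qed.

(** The separating points are the critical points of [floquet_disc], which do not
depend on theta. *)
Lemma bands_interlace :
  exists r : seq R, forall j theta, (j < 4)%N ->
    band a v j theta <= r`_j <= band a v j.+1 theta.
Proof.
(* At theta = 1 / 4 the level is 0, well inside the bands, and the spectrum is
   simple. *)
have [e0 [_ sz0 s0 def_e0]] := bands_are_roots (4^-1).
have level0 : bloch_level (4^-1) = 0.
  rewrite /bloch_level (_ : 2 * pi * 4^-1 = pi / 2); first by rewrite cos_pihalf mulr0.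
  by field.
have /(common_interlacing sz0)[r inter] : sorted <%R e0.
  apply: simple_roots_strictly_sorted => // l.
  rewrite (deriv_shifted_disc def_e0) def_e0 level0 subr0.
  rewrite horner_floquet_disc deriv_floquet_disc.
  move=> d0; apply: (sum_chain4_neq0 edge_weight_gt0).
  by rewrite d0 expr2 mul0r mulr_gt0 // weight_gt0 // => i; exact: edge_weight_gt0.
exists r => j theta j4; have [e [band_e sz s def_e]] := bands_are_roots theta.
rewrite !band_e; apply: inter => //.
by rewrite (deriv_shifted_disc def_e) (deriv_shifted_disc def_e0).
Qed.

(** If the maximum of a band equals the minimum of the next, both are taken at the
same level, where l is then a double root; interior levels have none. Conversely a
double root coincides with the critical point that separates the two bands. *)
Lemma closed_gapP l : closed_gap a v l <->
  forall i, chain4 (fun i => l - v 0 i) edge_weight i = 0.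
Proof.
rewrite -(edge_degenerateP _ edge_weight_gt0) -deriv_floquet_disc.
split=> [[j [j4 [[t1 _ l1] _] [[t2 _ l2] _]]] | [d0 edge]].
  have [e1 [band1 sz1 _ def_e1]] := bands_are_roots t1.
  have [e2 [band2 sz2 _ def_e2]] := bands_are_roots t2.
  have b1 : bloch_level t1 = floquet_disc.[l].
    by apply: (bloch_level_root def_e1); rewrite -l1 band1 mem_nth // sz1 ltnW.
  have b2 : bloch_level t2 = floquet_disc.[l].
    by apply: (bloch_level_root def_e2); rewrite -l2 band2 mem_nth // sz2.
  have adj : e1`_j = e1`_j.+1.
    by rewrite -!band1 l1 -l2; apply: band_level; rewrite b1.
  have d0 : floquet_disc^`().[l] = 0.
    rewrite -(deriv_shifted_disc def_e1) -l1 band1.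
    by apply: equal_adjacent_double => //; rewrite sz1.
  split=> //; apply/le_anti; rewrite -horner_floquet_disc -b1 bloch_level_bound /=.
  rewrite leNgt; apply/negP; rewrite b1 horner_floquet_disc.
  by move/(sum_chain4_neq0 edge_weight_gt0); rewrite -deriv_floquet_disc d0 eqxx.
have [t0 t01 level] := edge_attained edge.
have [e [band_e sz s def_e]] := bands_are_roots t0.
have [||k [ksz k0 k1]] := double_root_adjacent (x := l) s.
- by rewrite def_e hornerD hornerN hornerC level subrr.
- by rewrite (deriv_shifted_disc def_e).
have [r inter] := bands_interlace.
rewrite sz in ksz.
have rk : r`_k = l.
  by apply/le_anti; have := inter k t0 ksz; rewrite !band_e k0 k1 andbC.
have t0_in : (`[0, 1]%classic : set R) t0 by rewrite /= in_itv.
exists k; split=> //; split.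
- by exists t0; rewrite ?band_e.
- by move=> _ [t _ <-]; rewrite -rk; have /andP[] := inter k t ksz.
- by exists t0; rewrite ?band_e.
- by move=> _ [t _ <-]; rewrite -rk; have /andP[] := inter k t ksz.
Qed.

End Floquet.

(** * The pentagon recurrence *)

Section Pentagon.
Variable R : realFieldType.
Implicit Types (x : 'I_5 -> R) (κ t : R).

(** For κ = 1 this is the rule of Coxeter's frieze patterns for the pentagon; for
κ = - 1 it is the same rule for - x. *)
Definition pentagon κ x := forall i, x i * x (σ i) - 1 = κ * x (σ (σ (σ i))).

Lemma pentagonN κ x : pentagon κ x -> pentagon (- κ) (fun i => - x i).
Proof. by move=> px i; rewrite mulrNN px mulrNN. Qed.

(** With unit couplings and vanishing 4-chains all 3-chains equal some κ with
κ ^ 2 = 1, and the 4-chain recursion then reads chain2 i = κ * x (i + 3). *)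
Lemma unit_chains_degenerateP x :
  (forall i, chain4 x (fun=> 1) i = 0) <-> pentagon 1 x \/ pentagon (- 1) x.
Proof.
split=> [all0|].
  have [_ edge] := (edge_degenerateP x (fun=> ltr01 : 0 < 1 :> R)).2 all0.
  have chain3E i : chain3 x (fun=> 1) i = - disc x (fun=> 1) / 2.
    by have := degenerate_chain3 all0 (σ (σ (σ i))); rewrite ordS5 mul1r.
  have rel i : x i * x (σ i) - 1 = (- disc x (fun=> 1) / 2) * x (σ (σ (σ i))).
    have := all0 (σ (σ (σ i))); rewrite /chain4 chain3E ordS5 /chain2; lra.
  move: edge; rewrite /weight !mulr1 => edge.
  have : (- disc x (fun=> 1) / 2 - 1) * (- disc x (fun=> 1) / 2 + 1) = 0 by lra.
  move/eqP; rewrite mulf_eq0 => /orP[]/eqP k; [left|right] => i; rewrite rel;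
    congr (_ * _); lra.
have main κ : κ ^+ 2 = 1 -> pentagon κ x -> forall i, chain4 x (fun=> 1) i = 0.
  move=> kk px.
  have chain2E i : chain2 x (fun=> 1) i = κ * x (σ (σ (σ i))) by exact: px.
  have chain3E i : chain3 x (fun=> 1) i = κ.
    have := px (σ (σ (σ (σ i)))); rewrite /chain3 chain2E mul1r !ordS5 => p4.
    rewrite mulrCA [x i * _]mulrC.
    have -> : x (σ (σ (σ (σ i)))) * x i = 1 + κ * x (σ (σ i)) by lra.
    by rewrite mulrDr mulr1 mulrA -expr2 kk mul1r addrK.
  by move=> i; rewrite /chain4 chain3E chain2E ordS5 mul1r mulrC subrr.
by case=> px; apply: main px; lra.
Qed.

(** Subtracting the two recurrences makes x i + x (i + 1) constant; five is odd. *)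
Lemma pentagon_pair_same_sign x t : t != 0 ->
  pentagon 1 x -> pentagon 1 (fun i => x i + t) -> forall i, x (σ i) = x i.
Proof.
move=> t0 px py.
have lin i : x i + x (σ i) = 1 - t.
  by apply: (mulfI t0); have := px i; have := py i; lra.
have := (lin (vtx 0), lin (vtx 1), lin (vtx 2), lin (vtx 3), lin (vtx 4)).
rewrite !ordS_vtx => -[] [] [] [] ? ? ? ? ?.
by apply: vtxP; rewrite !ordS_vtx; lra.
Qed.

(** Subtracting the recurrences gives a linear system which does have nonconstant
solutions for exceptional t (the golden ratio enters), so a quadratic relation is
needed as well. In terms of the differences d of x the two relations imply, for
each i, that d (i + 3) = 0 or x (i + 1) = - t / 2; a single vanishing difference
then forces the others to vanish. *)
Lemma pentagon_pair_opposite_sign x t : t != 0 ->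
  pentagon 1 x -> pentagon (- 1) (fun i => x i + t) -> forall i, x (σ i) = x i.
Proof.
move=> t0 px py; pose d i := x (σ i) - x i.
have lin i : t * (x i + x (σ i)) + 2 * x (σ (σ (σ i))) = - t - t ^+ 2.
  by have := px i; have := py i; lra.
have lind i : t * (d i + d (σ i)) + 2 * d (σ (σ (σ i))) = 0.
  by rewrite /d; have := lin i; have := lin (σ i); lra.
have nonlin i : x (σ i) * (d i + d (σ i)) = d (σ (σ (σ i))).
  by rewrite /d; have := px i; have := px (σ i); lra.
have alt i : d (σ (σ (σ i))) = 0 \/ x (σ i) = - t / 2.
  have : d (σ (σ (σ i))) * (2 * x (σ i) + t) = 0.
    rewrite -{1}(nonlin i) (_ : _ * _ * _ = x (σ i) *
      (t * (d i + d (σ i)) + 2 * (x (σ i) * (d i + d (σ i))))); last by ring.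
    by rewrite nonlin lind mulr0.
  by move/eqP; rewrite mulf_eq0 => /orP[]/eqP; [left|right]; lra.
have zero_pair i : d (σ (σ (σ i))) = 0 -> d i + d (σ i) = 0.
  by move=> d0; apply: (mulfI t0); have := lind i; rewrite d0; lra.
have pair_zero i : d i + d (σ i) = 0 -> d (σ (σ (σ i))) = 0.
  by move=> d0; have := lind i; rewrite d0; lra.
have one_zero i : d i = 0 -> forall j, d j = 0.
  move=> d0; have sum0 : d i + d (σ i) + d (σ (σ i)) + d (σ (σ (σ i)))
      + d (σ (σ (σ (σ i)))) = 0 by rewrite /d ordS5; ring.
  have p2 := zero_pair (σ (σ i)); have p3 := zero_pair (σ (σ (σ i))).
  have p4 := zero_pair (σ (σ (σ (σ i)))).
  have a0 := alt i; have a1 := alt (σ i); have a3 := alt (σ (σ (σ i))).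
  have a4 := alt (σ (σ (σ (σ i)))).
  rewrite !ordS5 in p2 p3 p4 a1 a3 a4.
  have d23 := p2 d0.
  have d1 : d (σ i) = 0.
    case: a3 => [//|x4]; case: a1 => [d4|x2]; first lra.
    have d2 : d (σ (σ i)) = 0 \/ d (σ i) = 0.
      case: a4 => [|x0]; first by left.
      by case: a0 => [d3|x1]; [left|right; rewrite /d]; lra.
    by case: d2 => // d2; have := p4 d2; lra.
  have d4 : d (σ (σ (σ (σ i)))) = 0 by lra.
  have d3 := p3 d1.
  move=> j; have [k k5 <-] := ordS_orbit i j.
  by case: k k5 => [|[|[|[|[|]]]]] //= _; lra.
have [[i di]|nz] : (exists i, d i = 0) \/ forall i, x i = - t / 2.
  case: (pickP (fun i => d i == 0)) => [i /eqP|nz]; first by left; exists i.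
  right=> i; have [] := alt (σ (σ (σ (σ i)))); rewrite !ordS5 // => di.
  by have := nz (σ (σ i)); rewrite di eqxx.
  by move=> j; have := one_zero i di j; rewrite /d; lra.
by move=> i; rewrite !nz.
Qed.

Lemma pentagon_pair_constant κ κ' x t : κ = 1 \/ κ = - 1 -> κ' = 1 \/ κ' = - 1 ->
  t != 0 -> pentagon κ x -> pentagon κ' (fun i => x i + t) ->
  forall i, x (σ i) = x i.
Proof.
have from1 y t' κ1 : κ1 = 1 \/ κ1 = - 1 -> t' != 0 ->
    pentagon 1 y -> pentagon κ1 (fun i => y i + t') -> forall i, y (σ i) = y i.
  by case=> -> t0; [exact: pentagon_pair_same_sign|exact: pentagon_pair_opposite_sign].
move=> [->|->] k' t0 px py; first exact: from1 py.
move=> i; apply: oppr_inj; move: i; apply: (from1 _ (- t) (- κ')).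
- by case: k' => ->; [right|left]; rewrite ?opprK.
- by rewrite oppr_eq0.
- by rewrite -[1]opprK; apply: pentagonN.
move=> i; rewrite -!opprD; exact: (pentagonN py).
Qed.

End Pentagon.

(** * Counting closed gaps *)

Section Counting.
Variables (R : realType) (p : nat) (a v : 'rV[R]_p).

Lemma num_closed_gaps_ge (s : seq R) : uniq s ->
  (forall l, l \in s -> closed_gap a v l) -> (size s <= num_closed_gaps a v)%N.
Proof.
move=> us gaps; apply: uniq_leq_size => // l /gaps gl.
by rewrite (in_fset_set (finite_closed_gaps a v)); exact: mem_set.
Qed.

Lemma num_closed_gaps_le (s : seq R) :
  (forall l, closed_gap a v l -> l \in s) -> (num_closed_gaps a v <= size s)%N.
Proof.
move=> gaps; apply: uniq_leq_size; first exact: fset_uniq.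
by move=> l; rewrite (in_fset_set (finite_closed_gaps a v)) => /set_mem; exact: gaps.
Qed.

Lemma num_closed_gaps_ge1P : (1 <= num_closed_gaps a v)%N <-> exists l, closed_gap a v l.
Proof.
split=> [g1|[l gl]]; last first.
  by apply: (num_closed_gaps_ge (s := [:: l])) => // k; rewrite inE => /eqP->.
apply: contrapT => none.
have := num_closed_gaps_le (s := [::]); rewrite leqNgt g1 => H.
by have : false by apply: H => l gl; case: none; exists l.
Qed.

Lemma num_closed_gaps_le1 : (forall l k, closed_gap a v l -> closed_gap a v k -> k = l) ->
  (num_closed_gaps a v <= 1)%N.
Proof.
move=> same; have [[l gl]|none] := pselect (exists l, closed_gap a v l).
  by apply: (num_closed_gaps_le (s := [:: l])) => k gk; rewrite inE (same _ _ gl gk).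
by rewrite leqNgt; apply/negP => /ltnW /num_closed_gaps_ge1P.
Qed.

End Counting.

(** * Cyclic shifts of vectors *)

Section CyclicVectors.
Variable R : realType.

Lemma iter_cyc (n : nat) (v : 'rV[R]_n) k i : iter k cyc v 0 i = v 0 (iter k (@ordS n) i).
Proof. by elim: k i => [//|k IHk] i; rewrite iterS mxE IHk -iterSr. Qed.

Lemma constant_not_irreducible (v : 'rV[R]_5) :
  (forall i, v 0 (σ i) = v 0 i) -> ~ irreducible_vec v.
Proof.
move=> const irr; have /irr/(congr1 val) // : iter (vtx 0) cyc v = iter (vtx 1) cyc v.
  by rewrite !vtxK //=; apply/rowP => i; rewrite mxE const.
by rewrite /= !inordK.
Qed.

Lemma injective_irreducible (v : 'rV[R]_5) : injective (v 0) -> irreducible_vec v.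
Proof.
move=> inj k m /(congr1 (fun w : 'rV_5 => w 0 (vtx 0))).
rewrite !iter_cyc => /inj /(congr1 val); rewrite /= !iter_ordS vtxK //.
by rewrite !add0n !modn_small // => /val_inj.
Qed.

Lemma row5E (x0 x1 x2 x3 x4 : R) (w := row5 x0 x1 x2 x3 x4) :
  (w 0 (vtx 0) = x0) * (w 0 (vtx 1) = x1) * (w 0 (vtx 2) = x2) *
  (w 0 (vtx 3) = x3) * (w 0 (vtx 4) = x4).
Proof. by rewrite /w !mxE !vtxK. Qed.

End CyclicVectors.

(** * Unit hopping *)

Section ConstantHopping.
Variable R : realType.
Implicit Types (v : 'rV[R]_5) (κ c l e : R).

Lemma dso_closed_gapP v l : closed_gap (const_mx 1) v l <->
  pentagon 1 (fun i => l - v 0 i) \/ pentagon (- 1) (fun i => l - v 0 i).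
Proof.
rewrite closed_gapP; last by move=> i; rewrite mxE.
rewrite (_ : edge_weight _ = fun=> 1); first exact: unit_chains_degenerateP.
by apply: funext => i; rewrite /edge_weight mxE expr1n.
Qed.

Lemma dso_g_ge1P v : (1 <= g_DSO v)%N <->
  exists c, pentagon 1 (fun i => v 0 i + c) \/ pentagon (- 1) (fun i => v 0 i + c).
Proof.
have neg c : (fun i => - (c - v 0 i)) = (fun i => v 0 i - c).
  by apply: funext => i; rewrite opprB.
rewrite num_closed_gaps_ge1P; split=> [[l]|[c H]]; last exists (- c).
  move/dso_closed_gapP => H; exists (- l); rewrite -neg.
  by case: H => /pentagonN; rewrite ?opprK; [right|left].
apply/dso_closed_gapP; have neg' : (fun i => - c - v 0 i) = fun i => - (v 0 i + c).
  by apply: funext => i; rewrite opprD addrC.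
by rewrite neg'; case: H => /pentagonN; rewrite ?opprK; [right|left].
Qed.

(** The form has a pole only where w_i w_(i+1) = 1, that is where w_(i+3) = 0. As
w = 0 violates the recurrence, some cyclic shift avoids the pole, and from there
the recurrence determines the other three entries. *)
Lemma pentagon_formP κ v : κ = 1 \/ κ = - 1 ->
  (exists c, pentagon κ (fun i => v 0 i + c)) <->
  (exists l e, l * e != 1 /\ add_cyc_form v
     (row5 l e ((l + κ) / (l * e - 1)) (κ * (l * e - 1)) ((e + κ) / (l * e - 1)))).
Proof.
move=> k1; have kk : κ * κ = 1 by case: k1 => ->; ring.
split=> [[c pv]|[l [e [le1 [k [c def_w]]]]]].
  pose w i := v 0 i + c.
  have [i wi] : exists i, w i * w (σ i) != 1.
    apply: contrapT => none; have all1 i : w i * w (σ i) = 1.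
      by apply/eqP; apply: contrapT => /negP ne; case: none; exists i.
    have w0 i : w i = 0.
      have := pv (σ (σ i)); rewrite -/(w _) -/(w _) -/(w _) all1 ordS5 subrr.
      by move/(congr1 (fun z => κ * z)); rewrite mulr0 mulrA kk mul1r.
    by have := all1 (vtx 0); rewrite w0 mul0r => /esym/eqP; rewrite oner_eq0.
  have [k k5 def_i] := ordS_orbit (vtx 0) i.
  pose u m := w (iter m (@ordS 5) i).
  exists (u 0%N), (u 1%N); split=> //; exists k, c.
  have wE j : (iter k cyc v + const_mx c) 0 (vtx j) = w (iter k (@ordS 5) (vtx j)).
    by rewrite mxE iter_cyc mxE.
  have uS m : iter k (@ordS 5) (iter m (@ordS 5) (vtx 0)) = iter m (@ordS 5) i.
    by rewrite -iterD addnC iterD def_i.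
  have n0 : u 0%N * u 1%N - 1 != 0 by rewrite subr_eq0.
  have rel m : u m * u m.+1 - 1 = κ * u m.+3 by exact: pv.
  have u5 m : u m.+3.+2 = u m by rewrite /u /= ordS5.
  have r0 := rel 0%N; have r2 := rel 2%N; have r3 := rel 3%N; rewrite !u5 in r2 r3.
  have u3 : u 3%N = κ * (u 0%N * u 1%N - 1) by rewrite r0 mulrA kk mul1r.
  have wu m : (m < 5)%N -> w (iter k (@ordS 5) (vtx m)) = u m.
    move=> m5; rewrite /u -uS; congr (w (iter _ _ _)); apply/val_inj.
    by rewrite /= iter_ordS !vtxK // add0n modn_small.
  apply/rowP; apply: vtxP; rewrite wE row5E wu //.
  - by apply/(canRL (mulfK n0)); move: r2; rewrite u3; case: k1 => ->; lra.
  - by apply/(canRL (mulfK n0)); move: r3; rewrite u3; case: k1 => ->; lra.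
exists c; apply: (@iter_ordS_surj _ k) => i.
have n0 : l * e - 1 != 0 by rewrite subr_eq0.
have wE j : v 0 (iter k (@ordS 5) j) + c =
    row5 l e ((l + κ) / (l * e - 1)) (κ * (l * e - 1)) ((e + κ) / (l * e - 1)) 0 j.
  by rewrite -def_w mxE iter_cyc mxE.
rewrite -!iterS !iterSr !wE; move: i.
by case: k1 => ->; apply: vtxP; rewrite !ordS_vtx !row5E; field.
Qed.

(** Moving from one gap to another translates l - v by a constant. *)
Lemma dso_two_gaps_constant v l k : closed_gap (const_mx 1) v l ->
  closed_gap (const_mx 1) v k -> k != l -> forall i, v 0 (σ i) = v 0 i.
Proof.
move=> /dso_closed_gapP gl /dso_closed_gapP gk kl i.
have sgn m : pentagon 1 (fun i => m - v 0 i) \/ pentagon (- 1) (fun i => m - v 0 i) ->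
    exists2 κ, κ = 1 \/ κ = - 1 & pentagon κ (fun i => m - v 0 i).
  by case=> ?; [exists 1; first by left | exists (- 1); first by right].
have [κ s1 p1] := sgn l gl; have [κ' s2 p2] := sgn k gk.
have shift : (fun i => k - v 0 i) = (fun i => (l - v 0 i) + (k - l)).
  by apply: funext => j; ring.
rewrite shift in p2; have kl0 : k - l != 0 by rewrite subr_eq0.
have := pentagon_pair_constant s1 s2 kl0 p1 p2 i; lra.
Qed.

(** The first family at l = 2, e = 3, where the five entries are distinct. *)
Lemma dso_example_irreducible : irreducible_vec (row5 2 3 (3 / 5) 5 (4 / 5) : 'rV[R]_5).
Proof.
apply: injective_irreducible.
by apply: vtxP; apply: vtxP; rewrite !row5E // => h; exfalso; lra.
Qed.

Lemma dso_example_gap : (1 <= g_DSO (row5 2 3 (3 / 5) 5 (4 / 5) : 'rV[R]_5))%N.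
Proof.
apply/dso_g_ge1P; exists 0; left.
by apply: vtxP; rewrite !ordS_vtx !row5E; lra.
Qed.

End ConstantHopping.

(** * Zero potential *)

Section ZeroPotential.
Variable R : realType.
Implicit Types (a : 'rV[R]_5) (l c : R) (t : 'I_5 -> R).

(** The vanishing of the 4-chains at l = 1 for zero potential, in terms of the
squared hopping amplitudes. *)
Definition unit_gap_relation t := forall i, t (σ i) = (1 - t i) * (1 - t (σ (σ i))).

Lemma chain4_const l t i : chain4 (fun=> l) t i =
  (l ^+ 2) ^+ 2 - (t i + t (σ i) + t (σ (σ i))) * l ^+ 2 + t i * t (σ (σ i)).
Proof. by rewrite /chain4 /chain3 /chain2; ring. Qed.

Lemma odjm_closed_gapP a l : positive_vec a -> closed_gap a (const_mx 0) l <->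
  forall i, chain4 (fun=> l) (edge_weight a) i = 0.
Proof.
move=> a0; rewrite closed_gapP //.
by rewrite (_ : (fun i => l - _) = fun=> l) //; apply: funext => i; rewrite mxE subr0.
Qed.

Lemma odjm_gap_neq0 a l : positive_vec a -> closed_gap a (const_mx 0) l -> l != 0.
Proof.
move=> a0 /(odjm_closed_gapP _ a0)/(_ (vtx 0)); rewrite chain4_const => H.
apply/eqP => l0; move: H; rewrite l0 expr0n /= expr0n /= mulr0 subr0 add0r => /eqP.
by rewrite mulf_eq0 !gt_eqF // edge_weight_gt0.
Qed.

Lemma odjm_gapN a l : positive_vec a -> closed_gap a (const_mx 0) l ->
  closed_gap a (const_mx 0) (- l).
Proof.
move=> a0 /(odjm_closed_gapP _ a0) gl; apply/(odjm_closed_gapP _ a0) => i.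
by rewrite chain4_const sqrrN -chain4_const.
Qed.

Lemma unit_gap_relationP a l : positive_vec a -> l != 0 ->
  closed_gap a (const_mx 0) l <-> unit_gap_relation (fun i => (l^-1 * a 0 i) ^+ 2).
Proof.
move=> a0 l0; rewrite odjm_closed_gapP //.
have l20 : l ^+ 2 != 0 by rewrite sqrf_eq0.
have sE i : edge_weight a i = l ^+ 2 * (l^-1 * a 0 i) ^+ 2.
  by rewrite /edge_weight exprMn exprVn mulrA mulfV // mul1r.
have factor i : chain4 (fun=> l) (edge_weight a) i = (l ^+ 2) ^+ 2 *
    ((1 - (l^-1 * a 0 i) ^+ 2) * (1 - (l^-1 * a 0 (σ (σ i))) ^+ 2)
     - (l^-1 * a 0 (σ i)) ^+ 2).
  by rewrite chain4_const !sE; ring.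
split=> H i; last first.
  by rewrite factor; have /= -> := H i; rewrite subrr mulr0.
have /eqP := H i; rewrite factor mulf_eq0 sqrf_eq0 (negPf l20) /= subr_eq0.
by move=> /eqP.
Qed.

Lemma odjm_g_ge2P a : positive_vec a -> (2 <= g_ODJM a)%N <->
  exists2 c, 0 < c & unit_gap_relation (fun i => (c * a 0 i) ^+ 2).
Proof.
move=> a0; split=> [g2|[c c0 qa]].
  have [l gl] : exists l, closed_gap a (const_mx 0) l.
    by apply/num_closed_gaps_ge1P; apply: ltnW.
  have l0 := odjm_gap_neq0 a0 gl.
  exists `|l^-1|; first by rewrite normr_gt0 invr_eq0.
  move/(unit_gap_relationP a0 l0): gl => q i.
  by rewrite !exprMn !real_normK ?num_real // -!exprMn; apply: q.
have gc : closed_gap a (const_mx 0) c^-1.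
  by apply/unit_gap_relationP; rewrite ?invr_eq0 ?gt_eqF // invrK.
apply: (num_closed_gaps_ge (s := [:: c^-1; - c^-1])).
  rewrite /= inE andbT; apply/eqP => h; have := invr_gt0 c; rewrite c0; lra.
move=> l; rewrite !inE => /orP[]/eqP-> //; exact: odjm_gapN.
Qed.

(** Each 4-chain is monic quadratic in l ^ 2, so its roots are k ^ 2 and l ^ 2 and
their sum is the sum of three consecutive squares, whatever the starting index. *)
Lemma odjm_two_gaps_constant a l k : positive_vec a ->
  closed_gap a (const_mx 0) l -> closed_gap a (const_mx 0) k ->
  k ^+ 2 != l ^+ 2 -> forall i, a 0 (σ i) = a 0 i.
Proof.
move=> a0 /(odjm_closed_gapP _ a0) gl /(odjm_closed_gapP _ a0) gk kl.
have vieta i : edge_weight a i + edge_weight a (σ i) + edge_weight a (σ (σ i)) =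
    k ^+ 2 + l ^+ 2.
  have kl0 : k ^+ 2 - l ^+ 2 != 0 by rewrite subr_eq0.
  by apply: (mulfI kl0); have := gl i; have := gk i; rewrite !chain4_const; lra.
have weq i : edge_weight a (σ i) = edge_weight a i.
  move: i; have := (vieta (vtx 0), vieta (vtx 1), vieta (vtx 2), vieta (vtx 3), vieta (vtx 4)).
  rewrite !ordS_vtx => -[] [] [] [] ? ? ? ? ?.
  by apply: vtxP; rewrite !ordS_vtx; lra.
move=> i; apply/eqP; rewrite -(@eqrXn2 _ 2) ?ltW //; apply/eqP; exact: weq.
Qed.

Lemma odjm_g_le2 a : positive_vec a -> irreducible_vec a -> (g_ODJM a <= 2)%N.
Proof.
move=> a0 irr; have [[l gl]|none] := pselect (exists l, closed_gap a (const_mx 0) l).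
  apply: (num_closed_gaps_le (s := [:: l; - l])) => k gk.
  rewrite !inE -eqf_sqr; apply: contrapT => /negP kl.
  exact: (constant_not_irreducible (odjm_two_gaps_constant a0 gl gk kl)).
by rewrite leqNgt; apply/negP => /ltnW/ltnW /num_closed_gaps_ge1P.
Qed.

(** Positivity makes 1 - t i and 1 - t (i + 2) have equal signs, hence all 1 - t i;
if they are positive, t 0 + t 1 = 1 - t 2 * (1 - t 0) is below 1. *)
Lemma unit_gap_relation_cases t : (forall i, 0 < t i) -> unit_gap_relation t ->
  (1 < t (vtx 0) /\ 1 < t (vtx 1)) \/ t (vtx 0) + t (vtx 1) < 1.
Proof.
move=> t0 q; have := (q (vtx 0), q (vtx 1), q (vtx 2), q (vtx 3), q (vtx 4)).
have := (t0 (vtx 0), t0 (vtx 1), t0 (vtx 2), t0 (vtx 3), t0 (vtx 4)).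
rewrite !ordS_vtx => -[] [] [] [] p0 p1 p2 p3 p4 [] [] [] [] q1 q2 q3 q4 q0.
have [lt1|gt1|e1] := ltrgtP (t (vtx 0)) 1.
- right; have : 0 < t (vtx 2) * (1 - t (vtx 0)) by rewrite mulr_gt0 // subr_gt0.
  lra.
- left; split=> //.
  have t2 : 1 < t (vtx 2) by rewrite ltNge; apply/negP => ?; nra.
  have t3 : 1 < t (vtx 3) by rewrite ltNge; apply/negP => ?; nra.
  by rewrite ltNge; apply/negP => ?; nra.
- by move: p1; rewrite q1 e1 subrr mul0r ltxx.
Qed.

(** The parameters are the first two entries after scaling the gap to 1; the shift
is trivial in this direction because no denominator can vanish. *)
Lemma odjm_formP a : positive_vec a ->
  (exists2 c, 0 < c & unit_gap_relation (fun i => (c * a 0 i) ^+ 2)) <->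
  exists al be : R,
       [/\ 0 < al, 0 < be,
           (1 < al /\ 1 < be) \/ al ^+ 2 + be ^+ 2 < 1 &
           mul_cyc_form a
             (row5 al be
                (Num.sqrt ((al ^+ 2 + be ^+ 2 - 1) / (al ^+ 2 - 1)))
                (al * be / Num.sqrt ((al ^+ 2 - 1) * (be ^+ 2 - 1)))
                (Num.sqrt ((al ^+ 2 + be ^+ 2 - 1) / (be ^+ 2 - 1))))].
Proof.
move=> a0; have sq_gt1 (x : R) : 0 < x -> (1 < x ^+ 2) = (1 < x).
  by move=> x0; rewrite expr_gt1 ?ltW.
split=> [[c c0 q]|[al [be [al0 be0 cases [k [c [c0 def_w]]]]]]].
  pose w i := c * a 0 i.
  have w0 i : 0 < w i by rewrite mulr_gt0.
  have sqrt_sq i : Num.sqrt (w i ^+ 2) = w i by rewrite sqrtr_sqr ger0_norm ?ltW.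
  have cases := unit_gap_relation_cases (fun i => exprn_gt0 2 (w0 i)) q.
  have := (q (vtx 0), q (vtx 1), q (vtx 2), q (vtx 3), q (vtx 4)).
  rewrite !ordS_vtx -!/(w _) => -[] [] [] [] q1 q2 q3 q4 q0.
  have [n0 n1] : w (vtx 0) ^+ 2 - 1 != 0 /\ w (vtx 1) ^+ 2 - 1 != 0.
    have := exprn_gt0 2 (w0 (vtx 0)); have := exprn_gt0 2 (w0 (vtx 1)).
    by case: cases => [[? ?]|?] ? ?; split; apply/eqP => ?; lra.
  exists (w (vtx 0)), (w (vtx 1)); split=> //.
    by case: cases => [[]|]; rewrite ?sq_gt1 //; [left|right].
  exists 0%N, c; split=> //=; apply/rowP; apply: vtxP; rewrite row5E mxE -/(w _) //.
  - rewrite -[LHS]sqrt_sq; congr Num.sqrt.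
    by apply/(canRL (mulfK n0)); lra.
  - have -> : (w (vtx 0) ^+ 2 - 1) * (w (vtx 1) ^+ 2 - 1) =
        (w (vtx 0) * w (vtx 1) / w (vtx 3)) ^+ 2.
      rewrite expr_div_n; apply/(canRL (mulfK _)); first by rewrite sqrf_eq0 gt_eqF.
      transitivity ((1 - w (vtx 0) ^+ 2) * (1 - w (vtx 2) ^+ 2)
                    * ((1 - w (vtx 4) ^+ 2) * (1 - w (vtx 1) ^+ 2))).
        by rewrite q3; ring.
      by rewrite -q1 -q0; ring.
    rewrite sqrtr_sqr ger0_norm ?divr_ge0 ?mulr_ge0 ?ltW //.
    by field; rewrite !gt_eqF.
  - rewrite -[LHS]sqrt_sq; congr Num.sqrt.
    by apply/(canRL (mulfK n1)); lra.
exists c => //; apply: (@iter_ordS_surj _ k) => i.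
have wE j : c * a 0 (iter k (@ordS 5) j) =
    (row5 al be
       (Num.sqrt ((al ^+ 2 + be ^+ 2 - 1) / (al ^+ 2 - 1)))
       (al * be / Num.sqrt ((al ^+ 2 - 1) * (be ^+ 2 - 1)))
       (Num.sqrt ((al ^+ 2 + be ^+ 2 - 1) / (be ^+ 2 - 1)))) 0 j.
  by rewrite -def_w mxE iter_cyc.
rewrite -!iterS !iterSr !wE {wE def_w}.
have p0 := exprn_gt0 2 al0; have p1 := exprn_gt0 2 be0.
rewrite -(sq_gt1 _ al0) -(sq_gt1 _ be0) in cases.
have [n0 n1] : al ^+ 2 - 1 != 0 /\ be ^+ 2 - 1 != 0.
  by case: cases => [[? ?]|?]; split; apply/eqP => ?; lra.
have [s2 s3 s4] : [/\ 0 <= (al ^+ 2 + be ^+ 2 - 1) / (al ^+ 2 - 1),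
    0 <= (al ^+ 2 - 1) * (be ^+ 2 - 1) & 0 <= (al ^+ 2 + be ^+ 2 - 1) / (be ^+ 2 - 1)].
  case: cases => [[? ?]|?].
    by split; apply: mulr_ge0; rewrite ?invr_ge0; lra.
  by split; rewrite -mulrNN -?invrN; apply: mulr_ge0; rewrite ?invr_ge0; lra.
move: i; apply: vtxP; rewrite !ordS_vtx !row5E ?exprMn ?exprVn ?sqr_sqrtr //;
  by field; rewrite ?n0 ?n1.
Qed.

Lemma odjm_example : exists a : 'rV[R]_5,
  [/\ positive_vec a, irreducible_vec a & (2 <= g_ODJM a)%N].
Proof.
(* The family at al ^ 2 = 2, be ^ 2 = 4, where the five squares are distinct. *)
pose s : 'rV[R]_5 := row5 2 4 5 (8 / 3) (5 / 3).
pose a : 'rV[R]_5 := \row_i Num.sqrt (s 0 i).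
have s0 i : 0 < s 0 i by move: i; apply: vtxP; rewrite row5E; lra.
have a0 : positive_vec a by move=> i; rewrite mxE sqrtr_gt0.
have sqa i : a 0 i ^+ 2 = s 0 i by rewrite mxE sqr_sqrtr // ltW.
exists a; split=> //.
  apply: injective_irreducible => i j /(congr1 (fun z => z ^+ 2)); rewrite !sqa.
  by move: i j; apply: vtxP; apply: vtxP; rewrite !row5E // => h; exfalso; lra.
apply/(odjm_g_ge2P a0); exists 1; first exact: ltr01.
by move=> i; rewrite !mul1r !sqa; move: i; apply: vtxP; rewrite !ordS_vtx !row5E; lra.
Qed.

End ZeroPotential.

Theorem theorem1p9 (R : realType) :
  (g_DSO_max R 5 1 /\
   forall v : 'rV[R]_5,
     (1 <= g_DSO v)%N <->
     (exists l e : R, l * e != 1 /\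
        add_cyc_form v (row5 l e ((l + 1) / (l * e - 1)) (l * e - 1)
                             ((e + 1) / (l * e - 1)))) \/
     (exists l e : R, l * e != 1 /\
        add_cyc_form v (row5 l e ((l - 1) / (l * e - 1)) (1 - l * e)
                             ((e - 1) / (l * e - 1)))))
  /\
  (g_ODJM_max R 5 2 /\
   forall a : 'rV[R]_5, positive_vec a ->
     (2 <= g_ODJM a)%N <->
     exists al be : R,
       [/\ 0 < al, 0 < be,
           (1 < al /\ 1 < be) \/ al ^+ 2 + be ^+ 2 < 1 &
           mul_cyc_form a
             (row5 al be
                (Num.sqrt ((al ^+ 2 + be ^+ 2 - 1) / (al ^+ 2 - 1)))
                (al * be / Num.sqrt ((al ^+ 2 - 1) * (be ^+ 2 - 1)))
                (Num.sqrt ((al ^+ 2 + be ^+ 2 - 1) / (be ^+ 2 - 1))))]).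
Proof.
split; split.
- have le1 (v : 'rV[R]_5) : irreducible_vec v -> (g_DSO v <= 1)%N.
    move=> irr; apply: num_closed_gaps_le1 => l k gl gk; apply: contrapT => /eqP kl.
    exact: (constant_not_irreducible (dso_two_gaps_constant gl gk kl)).
  split=> [|_ [v irr <-]]; last by rewrite leEnat le1.
  exists (row5 2 3 (3 / 5) 5 (4 / 5)); first exact: dso_example_irreducible.
  apply/eqP; rewrite eqn_leq dso_example_gap le1 //; exact: dso_example_irreducible.
- move=> v; rewrite dso_g_ge1P.
  have [to1 from1] := pentagon_formP v (or_introl erefl : (1 : R) = 1 \/ 1 = - 1).
  have [toN fromN] := pentagon_formP v (or_intror erefl : (- 1 : R) = 1 \/ - 1 = - 1).
  split=> [[c [pv|pv]]|[[l [e [le1 form]]]|[l [e [le1 form]]]]].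
  + have [|l [e [le1 form]]] := to1; first by exists c.
    by left; exists l, e; rewrite mul1r in form.
  + have [|l [e [le1 form]]] := toN; first by exists c.
    by right; exists l, e; rewrite mulN1r opprB in form.
  + by have [|c pv] := from1; [exists l, e; rewrite mul1r|exists c; left].
  + by have [|c pv] := fromN; [exists l, e; rewrite mulN1r opprB|exists c; right].
- split=> [|_ [a [a0 irr] <-]]; last by rewrite leEnat odjm_g_le2.
  have [a [a0 irr g2]] := odjm_example R.
  by exists a; [split|apply/eqP; rewrite eqn_leq g2 odjm_g_le2].
- by move=> a a0; split=> [/(odjm_g_ge2P a0)/(odjm_formP a0)|/(odjm_formP a0)/(odjm_g_ge2P a0)].
Qed.
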